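(* There is no invertible quadratic transformation of $\mathbb R^2$ whose associated quadratic form $\omega_1$ is semi-definite. That is, if $f:\mathbb R^2\to\mathbb R^2$, $(p,q)\mapsto(\tilde p,\tilde q)$, is given by $$\tilde p=a_{20}p^2+2a_{11}pq+a_{02}q^2+2a_{10}p+2a_{01}q+a_{00},$$ $$\tilde q=b_{20}p^2+2b_{11}pq+b_{02}q^2+2b_{10}p+2b_{01}q+b_{00}$$ with real coefficients, and the associated quadratic form $\omega_1$ is semi-definite, then $f$ is not invertible.
   Context: A transformation of $\mathbb R^2$ is called invertible if it is a bijection $\mathbb R^2\to\mathbb R^2$. The quadratic form associated with the quadratic transformation is the form on $\mathbb R^2$ given, for $\mathbf c=(c_1,c_2)\in\mathbb R^2$, by $$\omega_1(\mathbf c)=(a_{20}b_{11}-a_{11}b_{20})\,c_1^2+(a_{20}b_{02}-a_{02}b_{20})\,c_1c_2+(a_{11}b_{02}-a_{02}b_{11})\,c_2^2 .$$ Here ''semi-definite'' excludes both the zero form and definite forms: a quadratic form on $\mathbb R^2$ is called semi-definite if its symmetric matrix is nonzero but has zero determinant. *)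

(* Defs.v *)
From mathcomp Require Import all_boot all_order all_algebra.
From mathcomp Require Import reals.
Set Implicit Arguments.
Unset Strict Implicit.
Unset Printing Implicit Defensive.
Import GRing.Theory.
Local Open Scope ring_scope.

(* Points of the plane are row vectors v = (v 0 0, v 0 1). *)

(* The linear coefficients and the pq coefficient carry a factor 2. *)
Definition quad_poly (R : realType) (a20 a11 a02 a10 a01 a00 : R)
    (v : 'rV[R]_2) : R :=
  let p := v 0 0 in let q := v 0 1 in
  a20 * p ^+ 2 + 2 * a11 * p * q + a02 * q ^+ 2
  + 2 * a10 * p + 2 * a01 * q + a00.

Definition quad_transform (R : realType)
    (a20 a11 a02 a10 a01 a00 b20 b11 b02 b10 b01 b00 : R)
    (v : 'rV[R]_2) : 'rV[R]_2 :=
  \row_(j < 2) if j == 0 then quad_poly a20 a11 a02 a10 a01 a00 v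
               else quad_poly b20 b11 b02 b10 b01 b00 v.

Definition omega1 (R : realType) (a20 a11 a02 b20 b11 b02 : R)
    (c : 'rV[R]_2) : R :=
  let c1 := c 0 0 in let c2 := c 0 1 in
  (a20 * b11 - a11 * b20) * c1 ^+ 2 + (a20 * b02 - a02 * b20) * c1 * c2
  + (a11 * b02 - a02 * b11) * c2 ^+ 2.

Definition sym_matrix_of (R : realType) (w : 'rV[R]_2 -> R) (M : 'M[R]_2) :
    Prop :=
  M^T = M /\ forall c : 'rV[R]_2, w c = (c *m M *m c^T) 0 0.

(* The symmetric matrix of w is unique when it exists.  The zero form and the
   definite forms are excluded. *)
Definition semi_definite (R : realType) (w : 'rV[R]_2 -> R) : Prop :=
  exists M : 'M[R]_2, [/\ sym_matrix_of w M, M != 0 & \det M = 0].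

(* Main.v *)
Require Import Defs.
From mathcomp Require Import all_boot all_order all_algebra.
From mathcomp Require Import reals.
From mathcomp Require Import ring.
Import GRing.Theory Num.Theory.
Local Open Scope ring_scope.

(** Write f x = beta(x, x) + L x + const with beta symmetric bilinear, so that
    f (x + u) - f (x - u) = 4 beta(x, u) + 2 L u.  The linear map beta(-, u)
    has determinant omega1 u.  Hence, as soon as omega1 u <> 0, the equation
    2 beta(x, u) = - L u has a solution x, and f takes the same value at the
    distinct points x + u and x - u.  A semi-definite omega1 is nonzero, so
    such a u exists and f is not injective. *)

(** Polarization: for a nonzero entry [M i j], a basis vector works if [M i i] or [M j j] is
    nonzero; otherwise the form at the sum of the two basis vectors is [M i j + M j i], twice
    [M i j] by symmetry. *)
Lemma sym_form_nonzero {F : numFieldType} {n : nat} {M : 'M[F]_n} :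
  M^T = M -> M != 0 ->
  exists c : 'rV[F]_n, (c *m M *m c^T) 0 0 != 0.
Proof.
move=> symM /matrix0Pn[i [j Mij]].
pose b (c d : 'rV[F]_n) := (c *m M *m d^T) 0 0.
have b_delta k l : b (delta_mx 0 k) (delta_mx 0 l) = M k l.
  by rewrite /b trmx_delta -rowE -colE !mxE.
have bDl c c' d : b (c + c') d = b c d + b c' d.
  by rewrite /b !mulmxDl mxE.
have bDr c d d' : b c (d + d') = b c d + b c d'.
  by rewrite /b linearD mulmxDr mxE.
case: (eqVneq (M i i) 0) => [Mii|Mii]; last first.
  by exists (delta_mx 0 i); rewrite -/(b _ _) b_delta.
case: (eqVneq (M j j) 0) => [Mjj|Mjj]; last first.
  by exists (delta_mx 0 j); rewrite -/(b _ _) b_delta.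
exists (delta_mx 0 i + delta_mx 0 j); rewrite -/(b _ _).
rewrite bDl !bDr !b_delta Mii Mjj add0r addr0.
by rewrite -{2}symM mxE -mulr2n mulrn_eq0.
Qed.

Lemma quad_transform_not_injective {R : realType}
    (a20 a11 a02 a10 a01 a00 b20 b11 b02 b10 b01 b00 : R) (u : 'rV[R]_2) :
  omega1 a20 a11 a02 b20 b11 b02 u != 0 ->
  ~ injective (quad_transform a20 a11 a02 a10 a01 a00
                              b20 b11 b02 b10 b01 b00).
Proof.
move=> w_neq0 inj_f; set w := omega1 _ _ _ _ _ _ u in w_neq0.
pose u1 := u 0 0; pose u2 := u 0 1.
(* [w_neq0] unfolded, in the shape of the side condition that [field] leaves. *)
have wE : (a20 * b11 - a11 * b20) * u1 ^+ 2 + (a20 * b02 - a02 * b20) * u1 * u2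
          + (a11 * b02 - a02 * b11) * u2 ^+ 2 != 0 by [].
pose r := a10 * u1 + a01 * u2; pose s := b10 * u1 + b01 * u2.
(* Cramer's rule for 2 beta(x, u) = - L u. *)
pose x : 'rV[R]_2 := \row_j if j == 0
  then (s * (a11 * u1 + a02 * u2) - r * (b11 * u1 + b02 * u2)) / w
  else (r * (b20 * u1 + b11 * u2) - s * (a20 * u1 + a11 * u2)) / w.
have eq_f : x + u = x - u.
  apply: inj_f; apply/rowP => j; rewrite !mxE.
  case: (j == 0); rewrite /quad_poly !mxE /= -/u1 -/u2 /w /omega1 -/u1 -/u2;
    rewrite /r /s; field; exact: wE.
(* Cancelling [x] leaves [u = - u], hence twice each coordinate of [u] vanishes. *)
have u0 : u = 0.
  apply/rowP => j; have /rowP/(_ j) := eq_f; rewrite !mxE => /addrI/eqP.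
  by rewrite -addr_eq0 -mulr2n mulrn_eq0 => /eqP.
by move: w_neq0; rewrite /w /omega1 u0 !mxE expr2 !mulr0 !addr0 eqxx.
Qed.

Theorem theorem5p3 (R : realType)
    (a20 a11 a02 a10 a01 a00 b20 b11 b02 b10 b01 b00 : R) :
  semi_definite (omega1 a20 a11 a02 b20 b11 b02) ->
  ~ bijective (quad_transform a20 a11 a02 a10 a01 a00
                              b20 b11 b02 b10 b01 b00).
Proof.
move=> [M [[symM wE] M_neq0 _]] /bij_inj.
have [u] := sym_form_nonzero symM M_neq0.
by rewrite -wE; apply: quad_transform_not_injective.
Qed.
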